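(* Let $1\le p<+\infty$ and $\nu_1,\nu_2>0$. Then there exist constants $c,C>0$ such that for every $f\in L^p(X,\mu)$ $$c\,\sup_{r>0}E_{p,\sigma_{\nu_1\beta_1,\nu_2\beta_2}}(f,r)\le\|f\|_{p,\sigma_{\nu_1,\nu_2}}^p\le C\,\sup_{r>0}E_{p,\sigma_{\nu_1\beta_1,\nu_2\beta_2}}(f,r).$$
   Context: Notation: for $\alpha,\beta>0$, $\sigma_{\alpha,\beta}(x):=x^\alpha1_{[0,1]}(x)+x^\beta1_{(1,+\infty)}(x)$, $x\ge0$. Setting: $(X,d)$ is a locally compact complete metric space with open balls $B(x,r)=\{y:d(x,y)<r\}$, $\mu$ is a Radon measure, doubling and positive: there is $C>0$ with $0<\mu(B(x,2r))\le C\mu(B(x,r))<\infty$ for all $x\in X,r>0$. $(\mathcal E,\mathcal F)$ is a Dirichlet form on $L^2(X,\mu)$ with heat semigroup $\{P_t\}_{t\ge0}$, which is conservative ($P_t1=1$). Volume assumption: there are $\alpha_1,\alpha_2\ge1$ and $C>0$ with $C^{-1}\sigma_{\alpha_1,\alpha_2}(r)\le\mu(B(x,r))\le C\sigma_{\alpha_1,\alpha_2}(r)$ for all $x\in X,r>0$. Heat kernel assumption: $\{P_t\}$ has a heat kernel $p_t(x,y)$ (i.e. $P_tf(x)=\int_Xp_t(x,y)f(y)\,d\mu(y)$) and there are $\beta_1,\beta_2$ with $2\le\beta_i\le1+\alpha_i$ ($i=1,2$) such that $p_t(x,y)$ is bounded above and below by expressions of the form $$\frac{C}{\sigma_{\alpha_1/\beta_1,\alpha_2/\beta_2}(t)}\exp\Big(-c\Big(\frac{d(x,y)^{\beta_1}}t\Big)^{\frac1{\beta_1-1}}\Big)\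 \text{if } t<d(x,y),\qquad \frac{C}{\sigma_{\alpha_1/\beta_1,\alpha_2/\beta_2}(t)}\exp\Big(-c\Big(\frac{d(x,y)^{\beta_2}}t\Big)^{\frac1{\beta_2-1}}\Big)\ \text{if } t\ge d(x,y),$$ for $x,y\in X$, $t>0$, with positive constants $c,C$ that may differ in the upper and lower bounds. Functionals: for non-decreasing $h:[0,\infty)\to[0,\infty)$ with $h(0)=0$, $\|f\|_{p,h}:=\sup_{t>0}\frac1{h(t)}\big(\int_XP_t(|f-f(y)|^p)(y)\,d\mu(y)\big)^{1/p}$, i.e. $\sup_{t>0}\frac1{h(t)}\big(\int_X\int_X|f(x)-f(y)|^pp_t(x,y)\,d\mu(x)d\mu(y)\big)^{1/p}$. For an increasing homeomorphism $\Psi:[0,\infty)\to[0,\infty)$, $$E_{p,\Psi}(f,r):=\frac1{\Psi(r)^p}\int_X\frac1{\mu(B(y,r))}\int_{B(y,r)}|f(x)-f(y)|^p\,d\mu(x)\,d\mu(y).$$ *)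

(* Defs.v *)
From HB Require Import structures.
From mathcomp Require Import all_boot all_order all_algebra.
From mathcomp Require Import all_classical all_reals all_analysis.

Set Implicit Arguments.
Unset Strict Implicit.
Unset Printing Implicit Defensive.
Import Order.TTheory GRing.Theory Num.Theory.
Import numFieldNormedType.Exports.

Local Open Scope classical_set_scope.
Local Open Scope ring_scope.

(** Complete metric spaces equipped with their Borel sigma-algebra. *)
HB.mixin Record Measurable_isBorel d (T : Type)
    & Uniform T & Measurable d T := {
  measurable_borel : @measurable d T = <<s @open T >>
}.

#[short(type="borelCompleteMetricType")]
HB.structure Definition BorelCompleteMetric d (R : realType) :=
  {T of Metric R T & Complete T & Measurable d T & Measurable_isBorel d T}.

Definition sigma_fun (R : realType) (a b : R) (x : R) : R :=
  x `^ a * \1_(`[0, 1]) x + x `^ b * \1_(`]1, +oo[) x.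

Section measures.
Context {R : realType} {d : measure_display} {X : borelCompleteMetricType d R}.
Variable mu : {measure set X -> \bar R}.
Local Open Scope ereal_scope.

Definition radon_measure : Prop :=
  [/\ forall K : set X, compact K -> mu K < +oo,
      forall A : set X, measurable A ->
        mu A = ereal_inf [set mu U | U in [set U | open U /\ A `<=` U]] &
      forall U : set X, open U ->
        mu U = ereal_sup [set mu K | K in [set K | compact K /\ K `<=` U]]].

Definition doubling_measure : Prop :=
  exists2 C : R, (0 < C)%R & forall (x : X) (r : R), (0 < r)%R ->
    [/\ 0 < mu (ball x (2 * r)),
        mu (ball x (2 * r)) <= C%:E * mu (ball x r) &
        C%:E * mu (ball x r) < +oo].

Definition volume_bounds (a1 a2 : R) : Prop :=
  exists2 C : R, (0 < C)%R & forall (x : X) (r : R), (0 < r)%R ->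
    (C^-1 * sigma_fun a1 a2 r)%:E <= mu (ball x r)
      <= (C * sigma_fun a1 a2 r)%:E.

End measures.

Section dirichlet_forms.
Context {R : realType} {d : measure_display} {X : borelCompleteMetricType d R}.
Variable mu : {measure set X -> \bar R}.

(** Elements of L^2(X, mu) are represented by square-integrable functions;
    forms and operators are required to respect equality a.e. *)
Notation L2 := (Lfun mu 2%:E).

Definition L2inner (f g : X -> R) : R := \int[mu]_x (f x * g x).

Definition L2dist (f g : X -> R) : \bar R :=
  Lnorm mu 2%:E (EFin \o (f \- g)).

Definition form1 (E : (X -> R) -> (X -> R) -> R) (f g : X -> R) : R :=
  E f g + L2inner f g.

(** [F] is the domain of the form [E]; values of [E] outside [F] are
    irrelevant. *)
Record dirichlet_form (F : set (X -> R)) (E : (X -> R) -> (X -> R) -> R) :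
    Prop := {
  form_dom_L2 : forall f, F f -> f \in L2 ;
  form_dom_ae : forall f g, F f -> g \in L2 -> f = g %[ae mu] -> F g ;
  form_ae : forall f g h, F f -> F g -> F h -> f = g %[ae mu] ->
    E f h = E g h ;
  form_dom_linear : forall (a : R) f g, F f -> F g ->
    F (fun x => a * f x + g x) ;
  form_dom_dense : forall f, f \in L2 -> forall e : R, 0 < e ->
    exists2 g, F g & (L2dist f g < e%:E)%E ;
  form_linear : forall (a : R) f g h, F f -> F g -> F h ->
    E (fun x => a * f x + g x) h = a * E f h + E g h ;
  form_sym : forall f g, F f -> F g -> E f g = E g f ;
  form_ge0 : forall f, F f -> 0 <= E f f ;
  form_closed : forall u : nat -> X -> R, (forall n, F (u n)) ->
    (forall e : R, 0 < e -> exists N : nat, forall m n : nat,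
       (N <= m)%N -> (N <= n)%N -> form1 E (u m \- u n) (u m \- u n) < e) ->
    exists2 f, F f & form1 E (u n \- f) (u n \- f) @[n --> \oo] --> (0 : R) ;
  form_markov : forall f, F f ->
    let g := fun x => Num.min (Num.max (f x) 0) 1 in
    F g /\ E g g <= E f f
}.

(** [P] is the strongly continuous contraction semigroup on L^2 whose
    generator is the operator [A] associated with the form:
    [A f = g] iff [f \in F] and [E f h = - (g, h)] for all [h \in F]. *)
Record heat_semigroup (F : set (X -> R)) (E : (X -> R) -> (X -> R) -> R)
    (P : R -> (X -> R) -> X -> R) : Prop := {
  heat_L2 : forall t f, 0 <= t -> f \in L2 -> P t f \in L2 ;
  heat_ae : forall t f g, 0 <= t -> f \in L2 -> g \in L2 ->
    f = g %[ae mu] -> P t f = P t g %[ae mu] ;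
  heat_linear : forall t (a : R) f g, 0 <= t -> f \in L2 -> g \in L2 ->
    P t (fun x => a * f x + g x) = (fun x => a * P t f x + P t g x) %[ae mu] ;
  heat0 : forall f, f \in L2 -> P 0 f = f %[ae mu] ;
  heatD : forall s t f, 0 <= s -> 0 <= t -> f \in L2 ->
    P (s + t) f = P s (P t f) %[ae mu] ;
  heat_contraction : forall t f, 0 <= t -> f \in L2 ->
    (Lnorm mu 2%:E (EFin \o P t f) <= Lnorm mu 2%:E (EFin \o f))%E ;
  heat_continuous : forall f, f \in L2 ->
    L2dist (P t f) f @[t --> 0^'+] --> 0%E ;
  heat_generator : forall f g, f \in L2 -> g \in L2 ->
    (L2dist (fun x => t^-1 * (P t f x - f x)) g @[t --> 0^'+] --> 0%E) <->
    (F f /\ forall h, F h -> E f h = - L2inner g h)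
}.

(** [P_t 1 = 1], where [P_t 1] is the limit of [P_t (u n)] for
    nonnegative [u n] in L^2 increasing to [1]. *)
Definition conservative (P : R -> (X -> R) -> X -> R) : Prop :=
  forall t, 0 <= t -> forall u : nat -> X -> R,
    (forall n, u n \in L2) -> (forall n x, 0 <= u n x) ->
    (forall n x, u n x <= u n.+1 x) ->
    (forall x, u n x @[n --> \oo] --> (1 : R)) ->
    \forall x \ae mu, P t (u n) x @[n --> \oo] --> (1 : R).

(** Action of [P_t] on nonnegative functions through its kernel. *)
Definition kernel_op (k : R -> X -> X -> R) (t : R) (g : X -> \bar R)
    (x : X) : \bar R :=
  (\int[mu]_y ((k t x y)%:E * g y))%E.

Definition heat_kernel (P : R -> (X -> R) -> X -> R)
    (k : R -> X -> X -> R) : Prop :=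
  forall t, 0 < t ->
    measurable_fun [set: X * X] (fun z => k t z.1 z.2) /\
    forall f, f \in L2 ->
      \forall x \ae mu, (P t f x)%:E = kernel_op k t (EFin \o f) x.

Definition subgaussian (a1 a2 b1 b2 C c t : R) (x y : X) : R :=
  let r := mdist x y in
  C / sigma_fun (a1 / b1) (a2 / b2) t *
  (if t < r then expR (- c * (r `^ b1 / t) `^ (b1 - 1)^-1)
   else expR (- c * (r `^ b2 / t) `^ (b2 - 1)^-1)).

Definition subgaussian_bounds (a1 a2 b1 b2 : R) (k : R -> X -> X -> R) :
    Prop :=
  exists C1 c1 C2 c2 : R, [/\ 0 < C1, 0 < c1, 0 < C2, 0 < c2 &
    forall (t : R) (x y : X), 0 < t ->
      subgaussian a1 a2 b1 b2 C1 c1 t x y <= k t x y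
        <= subgaussian a1 a2 b1 b2 C2 c2 t x y].

Local Open Scope ereal_scope.

Definition heat_seminorm (k : R -> X -> X -> R) (p : R) (h : R -> R)
    (f : X -> R) : \bar R :=
  ereal_sup [set ((h t)^-1)%:E *
      (\int[mu]_y kernel_op k t (fun x => (`|f x - f y| `^ p)%:E) y) `^ p^-1
    | t in [set t : R | (0 < t)%R]].

Definition ball_energy (p : R) (Psi : R -> R) (f : X -> R) (r : R) : \bar R :=
  ((Psi r `^ p)^-1)%:E *
  \int[mu]_y ((mu (ball y r))^-1 *
              \int[mu]_(x in ball y r) (`|f x - f y| `^ p)%:E).

End dirichlet_forms.

(* Main.v *)
Require Import Defs.
From HB Require Import structures.
From mathcomp Require Import all_boot all_order all_algebra.
From mathcomp Require Import all_classical all_reals all_analysis.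
From mathcomp Require Import measurable_realfun ring.

(** The constants are uniform because the time [t] and the radius [r] are
    matched by [t = sigma_fun beta1 beta2 r]: the intrinsic radius of [t] is
    [rho = sigma_fun beta1^-1 beta2^-1 t], and in these units the volume factor
    of the heat kernel is the volume of the ball of radius [rho], while
    [sigma_fun nu1 nu2 t = sigma_fun (nu1 * beta1) (nu2 * beta2) rho].

    Ball energies are bounded by the heat seminorm because at the time matched
    with [r] the kernel is at least a multiple of [1 / mu (ball y r)] on the
    ball of radius [r] ([subgaussian_near]), so the integrand of the energy at
    radius [r] is pointwise below the one of the heat energy at time [t]
    ([ball_energy_le_heat_seminorm]).

    Conversely, the kernel at time [t] decays faster than any power of
    [mdist x y / rho] ([subgaussian_far], [expRN_le_powN]), whereas the volume
    of the balls and the normalization of the energies grow only polynomially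
    in [r / rho] ([sigma_fun_dilate]). Cutting the kernel into dyadic layers
    therefore bounds the heat energy by a geometric series of ball energies
    ([heat_energy_le]). The layers are defined by the values of the kernel
    rather than by the distance ([integral_layer_le]): level sets of the kernel
    are measurable in the product, and the Gaussian upper bound places them
    inside the strips [mdist x y < 2 ^+ n.+1 * rho], over which the integrals
    are controlled by the ball energies ([integral_strip_le_ball_energy]).
    Tonelli's theorem applies since the volume bounds make [mu] sigma-finite. *)

Set Implicit Arguments.
Unset Strict Implicit.
Unset Printing Implicit Defensive.
Import Order.TTheory GRing.Theory Num.Theory.
Import numFieldNormedType.Exports.

Local Open Scope classical_set_scope.
Local Open Scope ring_scope.

(** * Piecewise powers *)

Section sigma_fun_theory.
Context {R : realType}.
Implicit Types a b m p r l : R.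

Lemma sigma_funE a b r : 0 <= r ->
  sigma_fun a b r = if r <= 1 then r `^ a else r `^ b.
Proof.
move=> r0; rewrite /sigma_fun !indicE; case: (leP r 1) => r1.
  have -> : r \in `[0, 1]%classic by rewrite inE/= in_itv/= r0 r1.
  rewrite memNset ?mulr1 ?mulr0 ?addr0//=.
  by rewrite in_itv/= andbT; apply/negP; rewrite -leNgt.
rewrite memNset; first by rewrite mulr0 add0r mem_set ?mulr1//= in_itv/= r1.
by rewrite /= in_itv/= r0/=; apply/negP; rewrite -ltNge.
Qed.

Lemma sigma_fun_gt0 a b r : 0 < r -> 0 < sigma_fun a b r.
Proof.
by move=> r0; rewrite sigma_funE ?(ltW r0)//; case: ifP => _; exact: powR_gt0.
Qed.

Lemma powR_le1 r a : 0 <= r <= 1 -> 0 <= a -> r `^ a <= 1.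
Proof.
move=> /andP[r0 r1] a0; have <- : 1 `^ a = 1 :> R by rewrite powR1.
by apply: ge0_ler_powR; rewrite ?nnegrE.
Qed.

Lemma powR_gt1 r a : 1 < r -> 0 < a -> 1 < r `^ a.
Proof.
move=> r1 a0; have <- : 1 `^ a = 1 :> R by rewrite powR1.
by apply: gt0_ltr_powR; rewrite ?nnegrE ?ler01// ltW// (lt_trans _ r1).
Qed.

(** A positive power preserves both [[0, 1]] and [[1, +oo)], hence the case
    distinction is not altered by composition. *)
Lemma sigma_fun_comp a b a' b' r : 0 < r -> 0 < a' -> 0 < b' ->
  sigma_fun a b (sigma_fun a' b' r) = sigma_fun (a' * a) (b' * b) r.
Proof.
move=> r0 a'0 b'0; rewrite (sigma_funE a b); last by rewrite ltW// sigma_fun_gt0.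
rewrite !sigma_funE ?(ltW r0)//; case: (leP r 1) => r1.
  by rewrite powR_le1 ?r1 ?(ltW r0) ?(ltW a'0)// powRrM.
by rewrite leNgt powR_gt1//= powRrM.
Qed.

Lemma sigma_fun_powR a b r p : 0 < r ->
  sigma_fun a b r `^ p = sigma_fun (a * p) (b * p) r.
Proof.
by move=> r0; rewrite !sigma_funE ?(ltW r0)// !powRrM; case: ifP.
Qed.

Lemma sigma_funM a b a' b' r : 0 < r ->
  sigma_fun a b r * sigma_fun a' b' r = sigma_fun (a + a') (b + b') r.
Proof.
move=> r0; rewrite !sigma_funE ?(ltW r0)//.
by case: ifP => _; rewrite powRD// (gt_eqF r0) implybT.
Qed.

(** Across the break point, only the larger of the two exponents can be
    used: if [r <= 1 < l * r], then [(l * r) `^ b <= (l * r) `^ m], and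
    [r `^ m <= r `^ a] because [r <= 1]. *)
Lemma sigma_fun_dilate a b m l r : a <= m -> b <= m -> 0 <= m -> 1 <= l ->
  0 < r -> sigma_fun a b (l * r) <= l `^ m * sigma_fun a b r.
Proof.
move=> am bm m0 l1 r0; have l0 : 0 < l by rewrite (lt_le_trans ltr01).
have lr0 : 0 < l * r by rewrite mulr_gt0.
rewrite !sigma_funE ?(ltW r0) ?(ltW lr0)//; case: (leP (l * r) 1) => lr1.
  have r1 : r <= 1 by rewrite (le_trans _ lr1)// ler_peMl// (ltW r0).
  by rewrite r1/= powRM ?(ltW r0) ?(ltW l0)// ler_wpM2r ?powR_ge0// ler_powR.
case: (leP r 1) => r1; last first.
  by rewrite powRM ?(ltW r0) ?(ltW l0)// ler_wpM2r ?powR_ge0// ler_powR.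
apply: (@le_trans _ _ ((l * r) `^ m)); first by rewrite ler_powR// (ltW lr1).
rewrite powRM ?(ltW r0) ?(ltW l0)// ler_wpM2l ?powR_ge0//.
by apply: ger_powR; rewrite ?r0.
Qed.

End sigma_fun_theory.

(** * The sub-Gaussian envelope in units of the intrinsic radius *)

Section kernel_envelope.
Context {R : realType} {d : measure_display} {X : borelCompleteMetricType d R}.
Implicit Types (a b r t l c C : R) (x y : X).

(** The lower bound on [s] is weaker than the natural [l `^ b <= s], so that
    [s = r `^ b / t] with [t <= r = l] is covered as well. *)
Lemma le_powR_root b l s : 1 < b -> 0 <= l -> l `^ (b - 1) <= s ->
  l <= s `^ (b - 1)^-1.
Proof.
move=> b1 l0 ls; have b10 : 0 < b - 1 by rewrite subr_gt0.
have -> : l = (l `^ (b - 1)) `^ (b - 1)^-1.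
  by rewrite -powRrM mulfV ?gt_eqF// powRr1.
apply: ge0_ler_powR => //; first by rewrite invr_ge0 ltW.
- by rewrite nnegrE powR_ge0.
- by rewrite nnegrE (le_trans _ ls)// powR_ge0.
Qed.

Lemma scaled_exponent_ge b l t r : 1 < b -> 1 <= l -> 0 < t ->
  l * t `^ b^-1 <= r -> l <= (r `^ b / t) `^ (b - 1)^-1.
Proof.
move=> b1 l1 t0 lr; have b0 : 0 < b by rewrite (lt_trans ltr01).
have l0 : 0 <= l by rewrite (le_trans ler01).
apply: le_powR_root => //; rewrite ler_pdivlMr//.
apply: (@le_trans _ _ (l `^ b * t)).
  by rewrite ler_wpM2r ?(ltW t0)// ler_powR// gerBl.
have -> : l `^ b * t = (l * t `^ b^-1) `^ b.
  by rewrite powRM ?powR_ge0// -powRrM mulVf ?gt_eqF// powRr1// ltW.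
have lt0 : 0 <= l * t `^ b^-1 by rewrite mulr_ge0 ?powR_ge0.
apply: ge0_ler_powR => //; first exact: ltW.
by rewrite nnegrE (le_trans lt0).
Qed.

Lemma subgaussian_le a1 a2 b1 b2 C c t x y : 0 <= C -> 0 <= c -> 0 < t ->
  subgaussian a1 a2 b1 b2 C c t x y <= C / sigma_fun (a1 / b1) (a2 / b2) t.
Proof.
move=> C0 c0 t0; rewrite /subgaussian ler_piMr//.
  by rewrite divr_ge0// ltW// sigma_fun_gt0.
by case: ifP => _; rewrite -expR0 ler_expR mulNr oppr_le0 mulr_ge0// powR_ge0.
Qed.

Lemma subgaussian_gt0 a1 a2 b1 b2 C c t x y : 0 < C -> 0 < t ->
  0 < subgaussian a1 a2 b1 b2 C c t x y.
Proof.
move=> C0 t0; rewrite /subgaussian mulr_gt0// ?divr_gt0 ?sigma_fun_gt0//.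
by case: ifP => _; rewrite expR_gt0.
Qed.

(** In units of the intrinsic radius [sigma_fun b1^-1 b2^-1 t], the kernel
    decays at least exponentially. The two branches of the envelope that do
    not match the regime of [t] are harmless: for [t <= 1] the branch
    [mdist x y <= t] cannot occur beyond the intrinsic radius, and for
    [1 < t < mdist x y] the first exponent is at least [mdist x y]. *)
Lemma subgaussian_far a1 a2 b1 b2 C c t x y l : 1 < b1 -> 1 < b2 ->
  0 <= C -> 0 <= c -> 0 < t -> 1 < l ->
  l * sigma_fun b1^-1 b2^-1 t <= mdist x y ->
  subgaussian a1 a2 b1 b2 C c t x y <=
    C / sigma_fun (a1 / b1) (a2 / b2) t * expR (- c * l).
Proof.
move=> b11 b21 C0 c0 t0 l1 ld; rewrite /subgaussian ler_wpM2l//.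
  by rewrite divr_ge0// ltW// sigma_fun_gt0.
set r := mdist x y in ld *.
have b10 : 0 < b1 by rewrite (lt_trans ltr01).
have b20 : 0 < b2 by rewrite (lt_trans ltr01).
have l0 : 0 < l by rewrite (lt_trans ltr01).
suff H : if t < r then l <= (r `^ b1 / t) `^ (b1 - 1)^-1
         else l <= (r `^ b2 / t) `^ (b2 - 1)^-1.
  by move: H; case: ifP => _ H; rewrite ler_expR !mulNr lerN2 ler_wpM2l.
move: ld; rewrite sigma_funE ?(ltW t0)//; case: (leP t 1) => t1 ld.
  case: (ltP t r) => tr; first by apply: scaled_exponent_ge => //; exact: ltW.
  exfalso; move: tr; apply/negP; rewrite -ltNge (lt_le_trans _ ld)//.
  apply: (@le_lt_trans _ _ (t `^ b1^-1)); last by rewrite ltr_pMl ?powR_gt0.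
  rewrite -[leLHS]powRr1 ?(ltW t0)//.
  by apply: ger_powR; rewrite ?t0// invf_le1// ltW.
case: (ltP t r) => tr; last by apply: scaled_exponent_ge => //; exact: ltW.
apply: (@le_trans _ _ r).
  apply: le_trans ld; rewrite ler_peMr ?(ltW l0)//.
  by rewrite ltW// powR_gt1// invr_gt0.
have r0 : 0 < r by rewrite (lt_trans t0).
apply: le_powR_root => //; first exact: ltW.
have -> : r `^ b1 = r `^ (b1 - 1) * r.
  rewrite -{3}[r]powRr1 ?(ltW r0)// -powRD ?subrK//.
  by rewrite gt_eqF.
rewrite ler_pdivlMr//.
by rewrite ler_wpM2l ?powR_ge0// ltW.
Qed.

(** At the time for which [r] is the intrinsic radius, the kernel is
    comparable on the ball of radius [r] to the inverse of its volume. *)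
Lemma subgaussian_near a1 a2 b1 b2 C c r x y : 1 < b1 -> 1 < b2 ->
  0 <= C -> 0 <= c -> 0 < r -> mdist x y < r ->
  C * expR (- c) / sigma_fun a1 a2 r <=
    subgaussian a1 a2 b1 b2 C c (sigma_fun b1 b2 r) x y.
Proof.
move=> b11 b21 C0 c0 r0 dr.
have b10 : 0 < b1 by rewrite (lt_trans ltr01).
have b20 : 0 < b2 by rewrite (lt_trans ltr01).
rewrite /subgaussian sigma_fun_comp//.
rewrite [b1 * _]mulrC [b2 * _]mulrC !divfK ?gt_eqF// mulrAC.
rewrite ler_wpM2l//; first by rewrite divr_ge0// ltW// sigma_fun_gt0.
set D := mdist x y in dr *; set t := sigma_fun b1 b2 r.
have D0 : 0 <= D by exact: mdist_ge0.
have t0 : 0 < t by exact: sigma_fun_gt0.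
suff H : if t < D then D `^ b1 <= t else D `^ b2 <= t.
  move: H; case: ifP => _ H; rewrite ler_expR mulNr lerN2 ler_piMr//.
  - apply: powR_le1; last by rewrite invr_ge0 subr_ge0 ltW.
    by rewrite divr_ge0 ?powR_ge0 ?(ltW t0)//= ler_pdivrMr// mul1r.
  - apply: powR_le1; last by rewrite invr_ge0 subr_ge0 ltW.
    by rewrite divr_ge0 ?powR_ge0 ?(ltW t0)//= ler_pdivrMr// mul1r.
have mono b : 0 < b -> D `^ b <= r `^ b.
  move=> b0; apply: ge0_ler_powR; rewrite ?nnegrE//; [exact: ltW|exact: ltW|].
  exact: ltW.
have := erefl t; rewrite {1}/t sigma_funE ?(ltW r0)//.
case: (leP r 1) => r1 tE.
  case: (ltP t D) => tD; first by rewrite -tE mono.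
  apply: le_trans tD; have [->|Dn0] := eqVneq D 0; first by rewrite powR0 ?gt_eqF.
  rewrite -[leRHS]powRr1//; apply: ger_powR; last exact: ltW.
  by rewrite lt_neqAle eq_sym Dn0 D0 (le_trans (ltW dr)).
case: (ltP t D) => tD; last by rewrite -tE mono.
exfalso; move: (lt_trans tD dr); apply/negP; rewrite -leNgt -tE.
by rewrite -[leLHS]powRr1 ?(ltW r0)// ler_powR// ltW.
Qed.

(** Powers of [l] are all that dyadic sums need, and they make these sums
    geometric. The bound is the [n]-th power of [u <= expR u] at
    [u = c * l / n]. *)
Lemma expRN_le_powN c n : 0 < c -> exists2 A : R, 1 <= A &
  forall l, 0 < l -> expR (- c * l) <= A * l ^- n.
Proof.
move=> c0; case: n => [|n].
  exists 1 => // l l0; rewrite expr0 invr1 mulr1 -expR0 ler_expR.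
  by rewrite mulNr oppr_le0 mulr_ge0// ltW.
exists (1 + (n.+1%:R / c) ^+ n.+1).
  by rewrite lerDl exprn_ge0// divr_ge0// ltW.
move=> l l0; set u := c * l / n.+1%:R.
have u0 : 0 < u by rewrite /u divr_gt0 ?mulr_gt0.
have uE : u ^+ n.+1 <= expR (c * l).
  have -> : c * l = n.+1%:R * u by rewrite /u [RHS]mulrC divfK.
  rewrite mulrC expRM_natr lerXn2r ?nnegrE ?expR_ge0 ?(ltW u0)//.
  by apply: le_trans (expR_ge1Dx u); rewrite lerDr.
rewrite mulNr expRN; apply: (@le_trans _ _ (u ^- n.+1)).
  by rewrite lef_pV2// posrE ?expR_gt0// exprn_gt0.
rewrite -!exprVn /u invf_div invfM mulrA exprMn.
by rewrite ler_wpM2r ?lerDr// exprn_ge0// invr_ge0 ltW.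
Qed.

End kernel_envelope.

(** * Layers of a kernel *)
Section integration.
Local Open Scope ereal_scope.
Context {d : measure_display} {T : measurableType d} {R : realType}.

(** The integral of a nonnegative function is a supremum over the simple
    functions below it, so monotonicity holds for arbitrary functions. This
    is what allows integrals over moving balls to be compared as functions of
    the centre, whose measurability is not at hand. *)
Lemma le_integral_ge0 (mu : {measure set T -> \bar R}) (D : set T)
    (f g : T -> \bar R) :
  (forall x, D x -> 0 <= f x) -> (forall x, D x -> f x <= g x) ->
  \int[mu]_(x in D) f x <= \int[mu]_(x in D) g x.
Proof.
move=> f0 fg; have g0 x : D x -> 0 <= g x.
  by move=> Dx; exact: le_trans (f0 x Dx) (fg x Dx).
rewrite !ge0_integralE//; apply: le_ereal_sup => _ [h hf <-]; exists h => //.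
move=> x; apply: le_trans (hf x) _; rewrite !patchE.
by case: ifPn => // /[!inE]; exact: fg.
Qed.

(** Every point lies in a layer [lam n.+1 < K <= lam n]: take the first [n]
    with [lam n.+1 < K], which exists because [lam] tends to [0]. On that
    layer the [n]-th term of the series alone dominates [K * w]. *)
Lemma integral_layer_le (mu : {measure set T -> \bar R}) (K : T -> R)
    (w : T -> \bar R) (lam : R^nat) :
  measurable_fun setT K -> measurable_fun setT w -> (forall x, 0 <= w x) ->
  (forall x, 0 < K x)%R -> (forall x, K x <= lam 0%N)%R ->
  (forall n, 0 <= lam n)%R -> lam @ \oo --> 0%R ->
  \int[mu]_x ((K x)%:E * w x) <=
  \sum_(0 <= n <oo) ((lam n)%:E * \int[mu]_(x in [set x | lam n.+1 < K x]%R) w x).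
Proof.
move=> mK mw w0 K0 Klam lam0 cvlam.
pose A n := [set x | lam n.+1 < K x]%R.
have mA n : measurable (A n).
  rewrite -[A n]setTI [_ `&` _](_ : _ = setT `&` K @^-1` `]lam n.+1, +oo[%classic).
    by apply: mK.
  by rewrite !setTI; apply/seteqP; split => x /=; rewrite in_itv/= andbT.
have mwA n : measurable_fun setT (w \_ (A n)).
  by apply/(measurable_restrictT _ (mA n)); exact: measurable_funS mw.
have wA0 n x : 0 <= (w \_ (A n)) x by rewrite patchE; case: ifP.
rewrite (eq_eseriesr (g := fun n => \int[mu]_x ((lam n)%:E * (w \_ (A n)) x))).
  rewrite -integral_nneseries//; last 2 first.
  - by move=> n; exact: measurable_funeM.
  - by move=> n x _; rewrite mule_ge0 ?lee_fin.
  apply: le_integral_ge0 => x _; first by rewrite mule_ge0// lee_fin ltW.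
  have exn : exists n, (lam n.+1 < K x)%R.
    have /cvgrPdist_lt/(_ _ (K0 x))[N _ /(_ N.+1 (leqnSn N))] := cvlam.
    by rewrite sub0r normrN ger0_norm// => ?; exists N.
  have [n An nmin] := ex_minnP exn.
  have Kn : (K x <= lam n)%R.
    case: n An nmin => [//|n] An nmin; rewrite leNgt; apply/negP => /nmin.
    by rewrite ltnn.
  apply: (@le_trans _ _ ((lam n)%:E * (w \_ (A n)) x)).
    by rewrite patchE mem_set// lee_wpmul2r// lee_fin.
  apply: le_trans (nneseries_lim_ge n.+1 _); last first.
    by move=> i _ _; rewrite mule_ge0 ?lee_fin.
  rewrite big_nat_recr//= leeDr// sume_ge0// => i _.
  by rewrite mule_ge0 ?lee_fin.
move=> n _; rewrite ge0_integralZl//; last by rewrite lee_fin.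
by rewrite [in LHS]integral_mkcond.
Qed.

End integration.

(** * Balls and the volume *)

Section volume.
Context {d : measure_display} {R : realType} {X : borelCompleteMetricType d R}.

Lemma measurable_metric_ball (x : X) (r : R) : measurable (ball x r).
Proof.
rewrite measurable_borel; apply: sub_sigma_algebra; rewrite openE => y.
rewrite ballEmdist/= => xy; apply/nbhs_ballP.
exists (r - mdist x y) => /=; first by rewrite subr_gt0.
move=> z; rewrite !ballEmdist/= => yz.
by rewrite (le_lt_trans (metric_triangle _ y _))// -ltrBrDl.
Qed.

Lemma volume_bounds_sigma_finite (mu : {measure set X -> \bar R}) (a1 a2 : R) :
  volume_bounds mu a1 a2 -> sigma_finite setT mu.
Proof.
move=> [C C0 muV]; have [[x0 _]|X0] := pselect (exists x : X, True).
  exists (fun n => ball x0 n.+1%:R).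
    apply/seteqP; split => x _ //; have xn := archi_boundP (mdist_ge0 x0 x).
    exists (Num.bound (mdist x0 x)) => //; rewrite ballEmdist/=.
    by rewrite (lt_trans xn)// ltr_nat.
  move=> n; split; first exact: measurable_metric_ball.
  by have /andP[_ /le_lt_trans->] := muV x0 n.+1%:R (ltr0Sn _ _); rewrite ?ltry.
exists (fun=> set0); last by move=> n; rewrite measure0; split.
by apply/seteqP; split => x // _; case: X0; exists x.
Qed.

End volume.

(** * Ball energies and heat energies *)

Section energies.
Local Open Scope ereal_scope.
Context {d : measure_display} {R : realType} {X : borelCompleteMetricType d R}.
Implicit Types (mu : {sigma_finite_measure set X -> \bar R})
  (k : R -> X -> X -> R) (p t r : R) (f : X -> R) (Psi : R -> R).

Definition oscillation (p : R) (f : X -> R) (z : X * X) : \bar R :=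
  (`|f z.2 - f z.1| `^ p)%:E.

Lemma measurable_oscillation p f : measurable_fun [set: X] f ->
  measurable_fun [set: X * X] (oscillation p f).
Proof.
move=> mf; apply/measurable_EFinP.
apply: (@measurableT_comp _ _ _ _ _ _ (fun x : R => x `^ p)%R).
  exact: measurable_powR.
apply: measurableT_comp => //; apply: measurable_funB.
  exact: measurableT_comp mf measurable_snd.
exact: measurableT_comp mf measurable_fst.
Qed.

Lemma oscillation_ge0 p f z : 0 <= oscillation p f z.
Proof. by rewrite lee_fin powR_ge0. Qed.

Definition heat_energy (mu : {measure set X -> \bar R}) (k : R -> X -> X -> R)
    (p : R) (f : X -> R) (t : R) : \bar R :=
  \int[mu]_y kernel_op mu k t (fun x => (`|f x - f y| `^ p)%:E) y.

Lemma heat_energyE mu k p f t : measurable_fun [set: X] f ->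
  measurable_fun [set: X * X] (fun z => k t z.1 z.2) ->
  (forall x y, 0 <= k t x y)%R ->
  heat_energy mu k p f t =
  \int[mu \x mu]_z ((k t z.1 z.2)%:E * oscillation p f z).
Proof.
move=> mf mk k0; rewrite fubini_tonelli1//.
- by apply: emeasurable_funM; [exact/measurable_EFinP|exact: measurable_oscillation].
- by move=> z; rewrite mule_ge0 ?oscillation_ge0// lee_fin.
Qed.

Lemma ball_energy_ge0 (mu : {measure set X -> \bar R}) p Psi f r :
  0 <= ball_energy mu p Psi f r.
Proof.
rewrite mule_ge0//; first by rewrite lee_fin invr_ge0 powR_ge0.
apply: integral_ge0 => y _; rewrite mule_ge0 ?inve_ge0//.
by apply: integral_ge0 => x _; rewrite lee_fin powR_ge0.
Qed.

(** [A] stands for a superlevel set of the heat kernel, which is measurable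
    for the product sigma-algebra because the kernel is; Tonelli's theorem is
    applied to it. The strip [mdist z.1 z.2 < r] enters only through its
    sections, which are balls. *)
Lemma integral_strip_le_ball_energy mu p Psi f (r v : R) (A : set (X * X)) :
  measurable_fun [set: X] f -> measurable A ->
  (forall z, A z -> mdist z.1 z.2 < r)%R ->
  (0 < Psi r)%R -> (0 < v)%R ->
  (forall y, mu (ball y r) <= v%:E) ->
  \int[mu \x mu]_(z in A) oscillation p f z <=
  (v * Psi r `^ p)%:E * ball_energy mu p Psi f r.
Proof.
move=> mf mA Ar Psi0 v0 muv.
have mwA : measurable_fun setT (oscillation p f \_ A).
  apply/(measurable_restrictT _ mA).
  by apply: measurable_funS (measurable_oscillation p mf).
have wA0 z : 0 <= (oscillation p f \_ A) z.
  by rewrite patchE; case: ifP => // _; exact: oscillation_ge0.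
have Psip : (0 < Psi r `^ p)%R by exact: powR_gt0.
rewrite integral_mkcond fubini_tonelli1// /ball_energy.
rewrite [leRHS]muleA -EFinM mulfK ?gt_eqF//.
rewrite -lee_pdivrMl// -ge0_integralZl//; last 3 first.
- exact: measurable_fun_fubini_tonelli_F.
- by move=> y _; apply: integral_ge0 => x _.
- by rewrite lee_fin invr_ge0 ltW.
apply: le_integral_ge0 => y _.
  by rewrite mule_ge0 ?lee_fin ?invr_ge0 ?(ltW v0)//; exact: integral_ge0.
apply: lee_pmul.
- by rewrite lee_fin invr_ge0 ltW.
- exact: integral_ge0.
- have -> : (v^-1)%:E = v%:E^-1 by rewrite inver gt_eqF.
  by rewrite lee_pV2 ?inE ?measure_ge0 ?lee_fin ?(ltW v0) ?muv//.
- rewrite [leRHS]integral_mkcond; apply: le_integral_ge0 => x _ //.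
  rewrite !patchE; case: ifPn => [/set_mem/Ar/= yx|_].
    by rewrite mem_set// ballEmdist.
  by case: ifPn => // _; rewrite lee_fin powR_ge0.
Qed.

Lemma ball_energy_le_heat_energy mu k p Psi f (r t v q : R) :
  measurable_fun [set: X] f ->
  measurable_fun [set: X * X] (fun z => k t z.1 z.2) ->
  (forall x y, 0 <= k t x y)%R ->
  (forall x y, mdist x y < r -> q <= k t x y)%R ->
  (0 < Psi r)%R -> (0 < v)%R -> (0 < q)%R ->
  (forall y, v%:E <= mu (ball y r)) ->
  (v * q)%:E * ball_energy mu p Psi f r <=
    ((Psi r `^ p)^-1)%:E * heat_energy mu k p f t.
Proof.
move=> mf mk k0 kq Psi0 v0 q0 muv.
have vq0 : (0 < v * q)%R by rewrite mulr_gt0.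
rewrite /ball_energy muleCA lee_wpmul2l ?lee_fin ?invr_ge0 ?powR_ge0//.
rewrite -lee_pdivlMl// -ge0_integralZl//; last 3 first.
- apply: (@measurable_fun_fubini_tonelli_F _ _ _ _ _ mu
    (fun z => (k t z.1 z.2)%:E * oscillation p f z)).
    apply: emeasurable_funM; [exact/measurable_EFinP|].
    exact: measurable_oscillation.
  by move=> z; rewrite mule_ge0 ?oscillation_ge0// lee_fin.
- move=> y _; apply: integral_ge0 => x _.
  by rewrite mule_ge0 ?lee_fin ?powR_ge0.
- by rewrite lee_fin invr_ge0 ltW.
apply: le_integral_ge0 => y _.
  rewrite mule_ge0 ?inve_ge0//.
  by apply: integral_ge0 => x _; rewrite lee_fin powR_ge0.
rewrite invfM EFinM -muleA; apply: lee_pmul.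
- by rewrite inve_ge0.
- by apply: integral_ge0 => x _; rewrite lee_fin powR_ge0.
- have -> : (v^-1)%:E = v%:E^-1 by rewrite inver gt_eqF.
  by rewrite lee_pV2 ?inE ?measure_ge0 ?lee_fin ?(ltW v0) ?muv//.
rewrite lee_pdivlMl// -ge0_integralZl; last 4 first.
- exact: measurable_metric_ball.
- apply: measurable_funTS.
  exact: measurableT_comp (measurable_oscillation p mf) (pair1_measurable y).
- by move=> x _; rewrite lee_fin powR_ge0.
- by rewrite lee_fin ltW.
rewrite integral_mkcond; apply: le_integral_ge0 => x _; rewrite !patchE.
  by case: ifPn => // _; rewrite mule_ge0 ?lee_fin ?powR_ge0// ltW.
case: ifPn => [/set_mem|_]; last by rewrite mule_ge0 ?lee_fin ?powR_ge0.
by rewrite ballEmdist/= => /kq qk; rewrite lee_wpmul2r ?lee_fin ?powR_ge0.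
Qed.

Lemma heat_energy_ge0 (mu : {measure set X -> \bar R}) k p f t :
  (forall x y, 0 <= k t x y)%R -> 0 <= heat_energy mu k p f t.
Proof.
move=> k0; apply: integral_ge0 => y _; apply: integral_ge0 => x _.
by rewrite mule_ge0 ?lee_fin ?powR_ge0.
Qed.

Lemma le_heat_seminorm (mu : {measure set X -> \bar R}) k p (h : R -> R) f t :
  (0 < p)%R -> (0 < t)%R -> (0 < h t)%R -> (forall x y, 0 <= k t x y)%R ->
  ((h t `^ p)^-1)%:E * heat_energy mu k p f t <=
    heat_seminorm mu k p h f `^ p.
Proof.
move=> p0 t0 h0 k0; set J := heat_energy _ _ _ _ _.
have J0 : 0 <= J by exact: heat_energy_ge0.
have hV0 : (0 <= (h t)^-1)%R by rewrite invr_ge0 ltW.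
have -> : ((h t `^ p)^-1)%:E * J = (((h t)^-1)%:E * J `^ p^-1) `^ p.
  rewrite poweRM ?poweR_ge0// -poweRrM mulVf ?gt_eqF// poweRe1//.
  by rewrite poweR_EFin -powRN -powR_inv1 ?ltW// -powRrM mulN1r.
have hJ : ((h t)^-1)%:E * J `^ p^-1 <= heat_seminorm mu k p h f.
  by apply: ereal_sup_ubound; exists t.
have hJ0 : 0 <= ((h t)^-1)%:E * J `^ p^-1 by rewrite mule_ge0 ?poweR_ge0.
apply: gt0_ler_poweR => //; first exact: ltW.
- by rewrite in_itv/= hJ0 leey.
- by rewrite in_itv/= leey andbT (le_trans hJ0).
Qed.

(** Taking [p]-th roots and powers is monotone, so a bound on all the energies
    passes to the [p]-th power of their supremum. *)
Lemma heat_seminorm_le (mu : {measure set X -> \bar R}) k p (h : R -> R) f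
    (M : \bar R) :
  (0 < p)%R -> 0 <= M -> (forall t, 0 < t -> 0 < h t)%R ->
  (forall t x y, 0 < t -> 0 <= k t x y)%R ->
  (forall t, (0 < t)%R -> heat_energy mu k p f t <= (h t `^ p)%:E * M) ->
  heat_seminorm mu k p h f `^ p <= M.
Proof.
move=> p0 M0 h0 k0 JM.
have MV : (M `^ p^-1) `^ p = M by rewrite -poweRrM mulVf ?gt_eqF// poweRe1.
have sup0 : 0 <= heat_seminorm mu k p h f.
  apply: (@le_trans _ _ (((h 1%R)^-1)%:E * heat_energy mu k p f 1%R `^ p^-1)).
    by rewrite mule_ge0 ?poweR_ge0// lee_fin invr_ge0 ltW// h0.
  by apply: ereal_sup_ubound; exists 1%R => //=.
rewrite -MV; apply: gt0_ler_poweR; first exact: ltW.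
- by rewrite in_itv/= sup0 leey.
- by rewrite in_itv/= poweR_ge0 leey.
apply: ge_ereal_sup => _ [t /= t0 <-].
rewrite lee_pdivrMl ?h0//.
have -> : (h t)%:E = ((h t `^ p)%:E) `^ p^-1.
  by rewrite poweR_EFin -powRrM mulfV ?gt_eqF// powRr1// ltW// h0.
rewrite -poweRM ?lee_fin ?powR_ge0//.
apply: gt0_ler_poweR.
- by rewrite invr_ge0 ltW.
- by rewrite in_itv/= leey heat_energy_ge0// => x y; exact: k0.
- by rewrite in_itv/= leey mule_ge0// lee_fin powR_ge0.
- exact: JM.
Qed.

End energies.

(** * Comparison of the two seminorms *)

Section comparison.
Context {d : measure_display} {R : realType} {X : borelCompleteMetricType d R}.

(** The kernel is cut at the levels [lam n], of order
    [2 ^- (n * m.+1) / vol], where [vol] is the volume of the intrinsic ball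
    and [m] bounds the growth exponent of [r |-> volume * Psi r `^ p]. The
    superlevel set of [lam n.+1] is contained in the strip of width
    [2 ^+ n.+1] intrinsic radii, whose integral costs at most a factor
    [2 ^+ (n.+1 * m)] more than the one of the intrinsic strip: the product
    is of order [2 ^- n] and sums up. *)
Lemma heat_energy_le (mu : {sigma_finite_measure set X -> \bar R})
    (k : R -> X -> X -> R) (a1 a2 b1 b2 nu1 nu2 p V C c : R) :
  0 <= a1 -> 0 <= a2 -> 1 < b1 -> 1 < b2 -> 0 < nu1 -> 0 < nu2 -> 0 < p ->
  0 < V -> 0 < C -> 0 < c ->
  (forall (x : X) (r : R), 0 < r -> (mu (ball x r) <= (V * sigma_fun a1 a2 r)%:E)%E) ->
  (forall t : R, 0 < t -> measurable_fun [set: X * X] (fun z => k t z.1 z.2)) ->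
  (forall (t : R) x y, 0 < t -> 0 < k t x y <= subgaussian a1 a2 b1 b2 C c t x y) ->
  exists2 K : R, 0 < K & forall f : X -> R, measurable_fun [set: X] f ->
    forall S : \bar R,
    (forall r : R, 0 < r ->
      (ball_energy mu p (sigma_fun (nu1 * b1) (nu2 * b2)) f r <= S)%E) ->
    forall t : R, 0 < t -> (heat_energy mu k p f t <=
      (sigma_fun nu1 nu2 t `^ p)%:E * (K%:E * S))%E.
Proof.
move=> a10 a20 b11 b21 nu10 nu20 p0 V0 C0 c0 muV mk kb.
have b10 : 0 < b1 by rewrite (lt_trans ltr01).
have b20 : 0 < b2 by rewrite (lt_trans ltr01).
set Psi := sigma_fun (nu1 * b1) (nu2 * b2).
set e1 := a1 + nu1 * b1 * p; set e2 := a2 + nu2 * b2 * p.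
have e10 : 0 <= e1 by rewrite addr_ge0 ?mulr_ge0// ltW.
have e20 : 0 <= e2 by rewrite addr_ge0 ?mulr_ge0// ltW.
pose m := Num.bound (e1 + e2).
have em : e1 + e2 <= m%:R by rewrite ltW// archi_boundP// addr_ge0.
have [A A1 expA] := expRN_le_powN m.+1 c0.
have A0 : 0 < A by rewrite (lt_le_trans ltr01).
exists (V * C * A * 2 ^+ m * 2); first by rewrite !mulr_gt0 ?exprn_gt0.
move=> f mf S ES t t0.
set h := sigma_fun nu1 nu2 t; have h0 : 0 < h by exact: sigma_fun_gt0.
have hp0 : 0 < h `^ p by exact: powR_gt0.
have S0 : (0 <= S)%E by rewrite (le_trans _ (ES 1 ltr01))// ball_energy_ge0.
(* With an infinite bound the claim is void; a finite one turns the series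
   below into a real geometric series. *)
have [->|SNy] := eqVneq S +oo%E.
  by rewrite gt0_muley ?lte_fin ?gt0_muley ?leey// !mulr_gt0 ?exprn_gt0.
have {SNy} [s Ss] : exists s : R, S = s%:E.
  by exists (fine S); rewrite fineK// ge0_fin_numE// lt_neqAle SNy leey.
have s0 : 0 <= s by rewrite -lee_fin -Ss.
set rho := sigma_fun b1^-1 b2^-1 t.
have rho0 : 0 < rho by exact: sigma_fun_gt0.
set vol := sigma_fun (a1 / b1) (a2 / b2) t.
have vol0 : 0 < vol by exact: sigma_fun_gt0.
have volE : sigma_fun a1 a2 rho = vol.
  by rewrite /rho sigma_fun_comp ?invr_gt0// [_ * a1]mulrC [_ * a2]mulrC.
have hE : Psi rho = h.
  rewrite /Psi /rho sigma_fun_comp ?invr_gt0// ![_^-1 * _]mulrC.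
  by rewrite !mulfK ?gt_eqF.
pose lam : R^nat := geometric (C * A / vol) (2 ^- m.+1).
have lamE n : lam n = C * A / vol * (2 ^+ n) ^- m.+1.
  by rewrite /lam/= exprVn -!exprM mulnC.
have q2 n : 0 < 2 ^+ n :> R by rewrite exprn_gt0.
have lam0 n : 0 <= lam n.
  by rewrite lamE mulr_ge0 ?divr_ge0 ?mulr_ge0 ?invr_ge0 ?exprn_ge0 ?ltW.
have k_le_lam n (z : X * X) : lam n.+1 < k t z.1 z.2 ->
    mdist z.1 z.2 < 2 ^+ n.+1 * rho.
  apply: contraTT; rewrite -!leNgt => rd.
  have /andP[_ kle] := kb t z.1 z.2 t0; apply: le_trans kle _.
  apply: le_trans (subgaussian_far _ _ b11 b21 _ _ _ _ rd) _ => //.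
  - exact: ltW.
  - exact: ltW.
  - by rewrite exprn_egt1// ltr1n.
  rewrite lamE [C * A / _]mulrAC -[leRHS]mulrA ler_wpM2l ?expA//.
  by rewrite divr_ge0// ltW.
rewrite heat_energyE//; last 2 first.
- exact: mk.
- by move=> x y; have /andP[/ltW] := kb t x y t0.
apply: le_trans (integral_layer_le (lam := lam) _ _ _ _ _ _ _ _) _.
- exact: mk.
- exact: measurable_oscillation.
- exact: oscillation_ge0.
- by move=> z; have /andP[] := kb t z.1 z.2 t0.
- move=> z; have /andP[_ kle] := kb t z.1 z.2 t0; apply: le_trans kle _.
  apply: le_trans (subgaussian_le _ _ _ _ _ _ (ltW C0) (ltW c0) t0) _.
  rewrite lamE expr0 expr1n invr1 mulr1 mulrAC ler_peMr//.
  by rewrite divr_ge0// ltW.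
- exact: lam0.
- apply: cvg_geometric; rewrite ger0_norm ?invr_ge0 ?exprn_ge0//.
  by rewrite invf_lt1 ?exprn_gt0// exprn_egt1// ltr1n.
(* The bound [Q] is spread over the layers with weights [1 / 2 ^ n.+1]. *)
set Q := h `^ p * (V * C * A * 2 ^+ m * 2) * s.
have -> : ((h `^ p)%:E * ((V * C * A * 2 ^+ m * 2)%:E * S))%E = Q%:E.
  by rewrite Ss -!EFinM mulrA.
have Q0 : 0 <= Q by rewrite /Q mulr_ge0// mulr_ge0 ?(ltW hp0)// ltW// !mulr_gt0.
have -> : Q%:E = (\sum_(0 <= n <oo) (Q / (2 ^ (n + 1))%:R)%:E)%E.
  apply/esym/cvg_lim => //.
  by have := @cvg_geometric_eseries_half R Q 0; rewrite expr0 divr1.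
apply: lee_nneseries => [n _ _|n _].
  by rewrite mule_ge0 ?lee_fin// integral_ge0// => z _; exact: oscillation_ge0.
pose r := 2 ^+ n.+1 * rho; have r0 : 0 < r by rewrite mulr_gt0.
apply: (@le_trans _ _
    ((lam n)%:E * ((V * sigma_fun a1 a2 r * Psi r `^ p)%:E * S))%E).
  rewrite lee_wpmul2l ?lee_fin//.
  apply: le_trans (integral_strip_le_ball_energy (r := r) (Psi := Psi)
    (v := V * sigma_fun a1 a2 r) p mf _ _ _ _ _) _.
  - rewrite -[X in measurable X]setTI.
    have := mk t t0; set kt := (fun z => _) => mkt.
    rewrite [X in setT `&` X](_ : _ = kt @^-1` `]lam n.+1, +oo[%classic).
      exact: mkt.
    by apply/seteqP; split => z /=; rewrite in_itv/= andbT.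
  - by move=> z /k_le_lam.
  - exact: sigma_fun_gt0.
  - by rewrite mulr_gt0 ?sigma_fun_gt0.
  - by move=> y; exact: muV.
  apply: lee_wpmul2l; last exact: ES.
  by rewrite lee_fin !mulr_ge0 ?powR_ge0// ltW// sigma_fun_gt0.
rewrite Ss -!EFinM lee_fin.
have scal : sigma_fun a1 a2 r * Psi r `^ p <=
    (2 ^+ n.+1) ^+ m * (vol * h `^ p).
  rewrite -volE -hE /Psi !sigma_fun_powR// !sigma_funM// -powR_mulrn ?(ltW (q2 _))//.
  apply: sigma_fun_dilate => //.
  - by rewrite (le_trans _ em)// lerDl.
  - by rewrite (le_trans _ em)// lerDr.
  - by rewrite exprn_ege1// ler1n.
rewrite mulrA; rewrite [leRHS](_ : _ =
    lam n * (V * ((2 ^+ n.+1) ^+ m * (vol * h `^ p))) * s).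
  by rewrite ler_wpM2r// ler_wpM2l// -mulrA ler_wpM2l// ltW.
rewrite /Q lamE addn1 natrX !exprS !exprMn.
set u := 2 ^+ n; have u0 : u != 0 by rewrite gt_eqF// q2.
have vol1 : vol != 0 by rewrite gt_eqF.
by field; rewrite expf_neq0// u0 vol1.
Qed.

(** A single time is enough for each radius: the one whose intrinsic radius
    is [r]. There the volume factors of the ball and of the kernel cancel. *)
Lemma ball_energy_le_heat_seminorm (mu : {sigma_finite_measure set X -> \bar R})
    (k : R -> X -> X -> R) (a1 a2 b1 b2 nu1 nu2 p V C c : R) :
  1 < b1 -> 1 < b2 -> 0 < nu1 -> 0 < nu2 -> 0 < p ->
  0 < V -> 0 < C -> 0 < c ->
  (forall (x : X) (r : R), 0 < r ->
    ((V * sigma_fun a1 a2 r)%:E <= mu (ball x r))%E) ->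
  (forall t : R, 0 < t -> measurable_fun [set: X * X] (fun z => k t z.1 z.2)) ->
  (forall (t : R) x y, 0 < t -> subgaussian a1 a2 b1 b2 C c t x y <= k t x y) ->
  exists2 K : R, 0 < K & forall f : X -> R, measurable_fun [set: X] f ->
    forall r : R, 0 < r ->
    (K%:E * ball_energy mu p (sigma_fun (nu1 * b1) (nu2 * b2)) f r <=
      heat_seminorm mu k p (sigma_fun nu1 nu2) f `^ p)%E.
Proof.
move=> b11 b21 nu10 nu20 p0 V0 C0 c0 muV mk kb.
have b10 : 0 < b1 by rewrite (lt_trans ltr01).
have b20 : 0 < b2 by rewrite (lt_trans ltr01).
exists (V * (C * expR (- c))); first by rewrite !mulr_gt0// expR_gt0.
move=> f mf r r0; set t := sigma_fun b1 b2 r.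
have t0 : 0 < t by exact: sigma_fun_gt0.
have vol0 : 0 < sigma_fun a1 a2 r by exact: sigma_fun_gt0.
have k0 x y : 0 <= k t x y.
  by apply: le_trans (kb t x y t0); rewrite ltW// subgaussian_gt0.
have hE : sigma_fun nu1 nu2 t = sigma_fun (nu1 * b1) (nu2 * b2) r.
  by rewrite sigma_fun_comp// [b1 * _]mulrC [b2 * _]mulrC.
apply: le_trans (le_heat_seminorm _ _ p0 t0 (sigma_fun_gt0 _ _ t0) k0).
rewrite hE [X in X%:E](_ : _ = V * sigma_fun a1 a2 r *
    (C * expR (- c) / sigma_fun a1 a2 r)).
  apply: ball_energy_le_heat_energy => //.
  - exact: mk.
  - move=> x y xy; apply: le_trans (kb t x y t0).
    by apply: subgaussian_near => //; exact: ltW.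
  - exact: sigma_fun_gt0.
  - exact: mulr_gt0.
  - by rewrite divr_gt0// mulr_gt0// expR_gt0.
  - by move=> y; exact: muV.
by rewrite mulrACA mulfV ?gt_eqF// mulr1.
Qed.

End comparison.

Theorem theorem3p4 (R : realType) (d : measure_display)
    (X : borelCompleteMetricType d R) (mu : {measure set X -> \bar R})
    (F : set (X -> R)) (E : (X -> R) -> (X -> R) -> R)
    (P : R -> (X -> R) -> X -> R) (k : R -> X -> X -> R)
    (alpha1 alpha2 beta1 beta2 : R)
    (Xlc : locally_compact [set: X])
    (muR : radon_measure mu) (mud : doubling_measure mu)
    (EF : dirichlet_form mu F E) (EP : heat_semigroup mu F E P)
    (P1 : conservative mu P)
    (a1 : 1 <= alpha1) (a2 : 1 <= alpha2)
    (muV : volume_bounds mu alpha1 alpha2)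
    (Pk : heat_kernel mu P k)
    (b1 : 2 <= beta1 <= 1 + alpha1) (b2 : 2 <= beta2 <= 1 + alpha2)
    (kB : subgaussian_bounds alpha1 alpha2 beta1 beta2 k)
    (p nu1 nu2 : R) (p1 : 1 <= p) (nu10 : 0 < nu1) (nu20 : 0 < nu2) :
  exists c C : R, [/\ 0 < c, 0 < C & forall f : X -> R,
    f \in Lfun mu p%:E ->
    let S := ereal_sup [set ball_energy mu p
                              (sigma_fun (nu1 * beta1) (nu2 * beta2)) f r
                        | r in [set r : R | 0 < r]] in
    (c%:E * S <= poweR (heat_seminorm mu k p (sigma_fun nu1 nu2) f) p
       <= C%:E * S)%E].
Proof.
have p0 : 0 < p by rewrite (lt_le_trans ltr01).
have a10 : 0 <= alpha1 by rewrite (le_trans ler01).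
have a20 : 0 <= alpha2 by rewrite (le_trans ler01).
have b11 : 1 < beta1 by case/andP: b1 => b1 _; rewrite (lt_le_trans _ b1)// ltr1n.
have b21 : 1 < beta2 by case/andP: b2 => b2 _; rewrite (lt_le_trans _ b2)// ltr1n.
have sf := volume_bounds_sigma_finite muV.
pose sfinP := isSFinite.Build _ _ _ (Measure.sort mu)
  (sfinite_measure_sigma_finite sf).
pose sigmaP := isSigmaFinite.Build _ _ _ (Measure.sort mu) sf.
pose mu' := HB.pack_for (SigmaFiniteMeasure.type X R) (Measure.sort mu)
  sfinP sigmaP.
have [V V0 muB] := muV.
have [C1 [c1 [C2 [c2 [C10 c10 C20 c20 kb]]]]] := kB.
have mk t : 0 < t -> measurable_fun [set: X * X] (fun z => k t z.1 z.2).
  by move=> t0; have [] := Pk t t0.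
have klow t x y : 0 < t ->
    subgaussian alpha1 alpha2 beta1 beta2 C1 c1 t x y <= k t x y.
  by move=> t0; have /andP[] := kb t x y t0.
have kup t x y : 0 < t ->
    0 < k t x y <= subgaussian alpha1 alpha2 beta1 beta2 C2 c2 t x y.
  move=> t0; have /andP[lo ->] := kb t x y t0; rewrite andbT.
  by rewrite (lt_le_trans _ lo)// subgaussian_gt0.
have VV0 : 0 < V^-1 by rewrite invr_gt0.
have [K K0 lowerE] := @ball_energy_le_heat_seminorm d R X mu' k alpha1 alpha2 beta1 beta2
  nu1 nu2 p _ _ _ b11 b21 nu10 nu20 p0 VV0 C10 c10
  (fun x r r0 => proj1 (andP (muB x r r0))) mk klow.
have [L L0 upperE] := @heat_energy_le d R X mu' k alpha1 alpha2 beta1 beta2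
  nu1 nu2 p _ _ _ a10 a20 b11 b21 nu10 nu20 p0 V0 C20 c20
  (fun x r r0 => proj2 (andP (muB x r r0))) mk kup.
exists K, L; split=> [//|//|f fLp].
lazy zeta; set S := ereal_sup _.
have mf : measurable_fun [set: X] f by move: fLp; rewrite inE => /andP[/[!inE]].
have ES r : 0 < r ->
    (ball_energy mu p (sigma_fun (nu1 * beta1) (nu2 * beta2)) f r <= S)%E.
  by move=> r0; apply: ereal_sup_ubound; exists r.
have S0 : (0 <= S)%E by rewrite (le_trans _ (ES 1 ltr01))// ball_energy_ge0.
apply/andP; split.
  rewrite -lee_pdivlMl//; apply: ge_ereal_sup => _ [r /= r0 <-].
  by rewrite lee_pdivlMl//; exact: lowerE.
apply: heat_seminorm_le => //.
- by rewrite mule_ge0// lee_fin ltW.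
- by move=> t t0; exact: sigma_fun_gt0.
- by move=> t x y t0; have /andP[/ltW] := kup t x y t0.
- exact: upperE.
Qed.
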